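(* Let $\mathbb{K}$ be a field, $R=\mathbb{K}[X_1,\ldots,X_n]$, and $J \subsetneq I \subset R$ monomial ideals. Fix a variable $X_i$ and let $I^1, J^1 \subset R[Y]$ be the $1$-step polarizations of $I$ and $J$ with respect to $X_i$. Then \[ \operatorname{sdepth} I/J = \operatorname{sdepth} I^1/J^1 - 1. \]
   Context: $1$-step polarization: if $u_1,\dots,u_m$ are the minimal monomial generators of a monomial ideal $I\subset R$, its $1$-step polarization with respect to $X_i$ is the ideal $I^1\subset R[Y]$ ($Y$ a new variable) generated by $v_1,\dots,v_m$, where $v_j=\frac{Y}{X_i}u_j$ if $X_i^2\mid u_j$, and $v_j=u_j$ otherwise. Stanley depth: with the fine multigrading, a Stanley decomposition of a finitely generated multigraded module $M$ is a finite family $(\mathbb{K}[Z_k], m_k)$ with $m_k$ homogeneous, $Z_k$ subsets of the variables, $m_k\mathbb{K}[Z_k]$ free over $\mathbb{K}[Z_k]$, and $M=\bigoplus_k m_k\mathbb{K}[Z_k]$ as multigraded $\mathbb{K}$-vector spaces; its depth is $\min_k|Z_k|$, and $\operatorname{sdepth}M$ is the maximal depth of a Stanley decomposition. *)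

(* Defs.v *)
From mathcomp Require Import all_boot all_order all_algebra.
From mathcomp Require Import mpoly.
From Stdlib Require Import ClassicalEpsilon.

Set Implicit Arguments.
Unset Strict Implicit.
Unset Printing Implicit Defensive.

Import GRing.Theory.
Local Open Scope ring_scope.

Section Defs.
Variables (K : fieldType) (n : nat).

Definition psubset := {mpoly K[n]} -> Prop.

Definition ideal_gen (S : psubset) : psubset :=
  fun f => exists r : seq ({mpoly K[n]} * {mpoly K[n]}),
    (forall p, p \in r -> S p.2) /\ f = \sum_(p <- r) p.1 * p.2.

Definition monset (s : seq 'X_{1..n}) : psubset :=
  fun p => exists2 m, m \in s & p = 'X_[m].

Definition monomial_ideal (I : psubset) : Prop :=
  exists s : seq 'X_{1..n}, forall f, I f <-> ideal_gen (monset s) f.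

Definition min_mon_gen (I : psubset) (m : 'X_{1..n}) : Prop :=
  I 'X_[m] /\ forall m', I 'X_[m'] -> (m' <= m)%MM -> m' = m.

Definition in_subring (Z : {set 'I_n}) (g : {mpoly K[n]}) : Prop :=
  forall m, m \in msupp g -> forall j, j \notin Z -> m j = 0%N.

(* A Stanley decomposition of the multigraded module I/J (J subset of I),
   given as a finite family D = [(m_k, Z_k)]_k; elements of I/J are
   represented by elements of I, and "= 0 in I/J" means "lies in J". *)
Definition stanley_decomposition (I J : psubset)
    (D : seq ({mpoly K[n]} * {set 'I_n})) : Prop :=
  let N := size D in
  let mk k := (nth (0, set0) D k).1 in
  let Zk k := (nth (0, set0) D k).2 in
  (* each m_k is a homogeneous element of I/J (fine multigrading) *)
  (forall k, (k < N)%N ->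
     I (mk k) /\ exists (c : K) (a : 'X_{1..n}), J (mk k - c *: 'X_[a])) /\
  (* m_k K[Z_k] is free over K[Z_k] *)
  (forall k, (k < N)%N -> forall g, in_subring (Zk k) g ->
     J (mk k * g) -> g = 0) /\
  (forall f, I f -> exists gs : nat -> {mpoly K[n]},
     (forall k, (k < N)%N -> in_subring (Zk k) (gs k)) /\
     J (f - \sum_(k < N) mk k * gs k)) /\
  (forall gs : nat -> {mpoly K[n]},
     (forall k, (k < N)%N -> in_subring (Zk k) (gs k)) ->
     J (\sum_(k < N) mk k * gs k) ->
     forall k, (k < N)%N -> J (mk k * gs k)).

Definition depth_ge (D : seq ({mpoly K[n]} * {set 'I_n})) (d : nat) : Prop :=
  forall p, p \in D -> (d <= #|p.2|)%N.

Definition has_sdecomp_ge (I J : psubset) (d : nat) : bool :=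
  if excluded_middle_informative
       (exists D, stanley_decomposition I J D /\ depth_ge D d)
  then true else false.

(* sdepth I/J: maximal depth of a Stanley decomposition
   (depths are at most n, the number of variables) *)
Definition sdepth (I J : psubset) : nat :=
  \max_(d < n.+1 | has_sdecomp_ge I J d) d.

End Defs.

Section Polarization.
Variables (K : fieldType) (n : nat).

(* R[Y] = {mpoly K[n.+1]}: variable X_j is index widen j, Y is index ord_max.
   polmon i u = (Y / X_i) u if X_i^2 | u, and u otherwise. *)
Definition polmon (i : 'I_n) (u : 'X_{1..n}) : 'X_{1..n.+1} :=
  [multinom (match unlift ord_max j with
              | Some k => if (k == i) && (1 < u k)%N then (u k).-1 else u k
              | None => if (1 < u i)%N then 1%N else 0%N
              end) | j < n.+1].

Definition polarization (i : 'I_n) (I : psubset K n) : psubset K n.+1 :=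
  ideal_gen (fun p => exists2 u, min_mon_gen I u & p = 'X_[polmon i u]).

End Polarization.

(* Main.v *)
(** Every multigraded piece of [I/J] has dimension at most one, so a Stanley
    decomposition of [I/J] is the same as a finite partition of the monomials of
    [I] outside [J] into cones [a + N^Z].  Writing exponents of [R[Y]] as
    [(e, x, y)], with [x], [y] the exponents of [X_i] and [Y], a monomial lies in
    [I^1] iff [(e, phi x y)] lies in [I], where [phi 0 y = 0], [phi x 0 = 1] for
    [x > 0] and [phi x y = x + 1] otherwise; the same holds for [J].

    The preimage under [phi] of a cone is a cone with one more free variable, so
    a partition for [I/J] of depth [d] gives one for [I^1/J^1] of depth [d + 1].
    Conversely, for [y] larger than every apex of a given partition for
    [I^1/J^1], the map [0 |-> (0, 0)], [1 |-> (1, 0)], [t |-> (t - 1, y)] is a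
    section of [phi] along which each cone pulls back to a finite disjoint union
    of cones having at most one free variable less. *)

Require Import Defs.
From mathcomp Require Import all_boot all_order all_algebra.
From mathcomp Require Import mpoly zify.
From Stdlib Require Import ClassicalEpsilon.

Set Implicit Arguments.
Unset Strict Implicit.
Unset Printing Implicit Defensive.

Import GRing.Theory.

Local Notation cone n := ('X_{1..n} * {set 'I_n})%type.

(** * Finite partitions into cones *)

Definition in_ray (free : bool) (a b : nat) : bool :=
  if free then a <= b else b == a.

Definition in_cone n (p : cone n) (b : 'X_{1..n}) : bool :=
  [forall j, in_ray (j \in p.2) (p.1 j) (b j)].

Definition cone_partition n (P : pred 'X_{1..n}) (C : seq (cone n)) : Prop :=
  forall b, \sum_(p <- C) in_cone p b = P b.

Definition cone_partitionable n (P : pred 'X_{1..n}) (d : nat) : Prop :=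
  exists2 C, cone_partition P C & forall p, p \in C -> d <= #|p.2|.

Lemma in_rayxx z a : in_ray z a a.
Proof. by case: z => /=. Qed.

Lemma leq_in_ray z a b : in_ray z a b -> a <= b.
Proof. by case: z => //= /eqP ->. Qed.

Lemma in_cone_apex n (p : cone n) : in_cone p p.1.
Proof. by apply/forallP => j; apply: in_rayxx. Qed.

Lemma in_cone_setT n (a b : 'X_{1..n}) :
  in_cone (a, [set: 'I_n]) b = (a <= b)%MM.
Proof.
by apply/forallP/mnm_lepP => H j; have := H j; rewrite /in_ray inE.
Qed.

Lemma lepm_in_cone n (p : cone n) b : in_cone p b -> (p.1 <= b)%MM.
Proof. by move/forallP => H; apply/mnm_lepP => j; apply: leq_in_ray (H j). Qed.

Lemma in_cone_addP n (p : cone n) (m : 'X_{1..n}) :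
  reflect (forall j, j \notin p.2 -> m j = 0) (in_cone p (p.1 + m)%MM).
Proof.
apply: (iffP forallP) => H j.
  by move=> /negPf jZ; have := H j; rewrite /in_ray jZ mnmDE; lia.
rewrite /in_ray mnmDE; case: ifP => [_|/negbT/H ->]; lia.
Qed.

Lemma in_cone_lift n (i : 'I_n.+1) (p : cone n.+1) m :
  in_cone p m = in_ray (i \in p.2) (p.1 i) (m i) &&
    [forall k, in_ray (lift i k \in p.2) (p.1 (lift i k)) (m (lift i k))].
Proof.
by rewrite -[LHS](big_andE xpredT) (bigD1_ord i) //= (big_andE xpredT).
Qed.

Lemma card_set_lift n (i : 'I_n.+1) (A : {set 'I_n.+1}) :
  #|A| = (i \in A) + #|lift i @^-1: A|.
Proof.
rewrite -!sum1_card big_mkcond (bigD1_ord i) //=; congr (_ + _).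
by rewrite [RHS]big_mkcond; apply: eq_bigr => k _; rewrite inE.
Qed.

Lemma forallD1 (T : finType) (i : T) (P : pred T) :
  [forall k, P k] = P i && [forall (k | k != i), P k].
Proof. by rewrite -[LHS](big_andE xpredT) (bigD1 i) //= big_andE. Qed.

Lemma cone_partitionableW n (P : pred 'X_{1..n}) d d' :
  d' <= d -> cone_partitionable P d -> cone_partitionable P d'.
Proof. by move=> le_d [C PC dC]; exists C => // p /dC; apply: leq_trans. Qed.

Lemma cone_partitionable_comp n m (f : 'X_{1..m} -> 'X_{1..n}) P C d :
  cone_partition P C ->
  (forall p, p \in C -> cone_partitionable (in_cone p \o f) d) ->
  cone_partitionable (P \o f) d.
Proof.
move=> PC pullC; suff [C' sumC' dC'] : exists2 C',
    forall b, \sum_(p <- C') in_cone p b = \sum_(p <- C) in_cone p (f b) &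
    forall p, p \in C' -> d <= #|p.2|.
  by exists C' => // b; rewrite sumC' PC.
elim: C {PC} pullC => [_|p C IH pullC].
  by exists [::] => // b; rewrite !big_nil.
have [L sumL dL] := pullC p (mem_head _ _).
have [|C' sumC' dC'] := IH.
  by move=> q qC; apply: pullC; rewrite inE qC orbT.
exists (L ++ C') => [b|q]; first by rewrite big_cat big_cons sumL sumC'.
by rewrite mem_cat => /orP[/dL|/dC'].
Qed.

Definition truncate_mon n (N : nat) (b : 'X_{1..n}) : 'X_{1..n} :=
  [multinom minn (b j) N | j < n].

Definition truncation_invariant n (N : nat) (P : pred 'X_{1..n}) : Prop :=
  forall b, P (truncate_mon N b) = P b.

Lemma truncation_invariantW n N N' (P : pred 'X_{1..n}) :
  N <= N' -> truncation_invariant N P -> truncation_invariant N' P.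
Proof.
move=> leN invP b; rewrite -invP -[RHS]invP; congr P.
by apply/mnmP => j; rewrite !mnmE -minnA (minn_idPr leN).
Qed.

(* The monomials with exponents at most [N] represent the classes of
   [truncate_mon N]; the class of [a] is the cone at [a] whose free directions
   are those in which [a] has exponent [N]. *)
Lemma truncation_invariant_partitionable n N (P : pred 'X_{1..n}) :
  truncation_invariant N P -> cone_partitionable P 0.
Proof.
move=> invP.
pose mon (f : {ffun 'I_n -> 'I_N.+1}) := [multinom (f j : nat) | j < n].
pose class f := (mon f, [set j | f j == ord_max]).
exists [seq class f | f <- enum {ffun 'I_n -> 'I_N.+1} & P (mon f)] => // b.
pose fb : {ffun 'I_n -> 'I_N.+1} := [ffun j => inord (minn (b j) N)].
have fbE j : fb j = minn (b j) N :> nat by rewrite ffunE inordK // ltnS geq_minr.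
have mon_fb : mon fb = truncate_mon N b by apply/mnmP => j; rewrite !mnmE fbE.
have in_class f : in_cone (class f) b = (f == fb).
  have rayE j : in_ray (j \in (class f).2) ((class f).1 j) (b j) = (f j == fb j).
    rewrite /in_ray /= inE -!val_eqE /= mnmE fbE.
    by have := ltn_ord (f j); case: ifP; lia.
  apply/forallP/eqP => [H|fE j]; last by rewrite rayE fE.
  by apply/ffunP => j; apply/eqP; rewrite -rayE.
rewrite big_map big_filter big_enum_cond /= -(invP b) -mon_fb.
under eq_bigr do rewrite in_class.
rewrite big_mkcond (bigD1 fb) //= eqxx big1 => [|f /negPf ->].
  by rewrite addn0; case: (P _).
by rewrite if_same.
Qed.

(** * Exponents under one-step polarization *)

(* A monomial [X_i^x Y^y] lies above the polarization of [X_i^a] iff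
   [a <= depol_exp x y]. *)
Definition depol_exp (x y : nat) : nat :=
  if x is 0 then 0 else if y is 0 then 1 else x.+1.

(* At [y = 1] these are the exponents of [X_i] and [Y] in the polarization of
   [X_i^t]. *)
Definition pol_expX (t : nat) : nat := if 1 < t then t.-1 else t.
Definition pol_expY (y t : nat) : nat := if 1 < t then y else 0.

Lemma pol_expK y t : 0 < y -> depol_exp (pol_expX t) (pol_expY y t) = t.
Proof. by case: y t => [|y] [|[|t]]. Qed.

Lemma in_ray_depol_exp z a x y :
  in_ray z a (depol_exp x y) =
  in_ray (z || (a == 1)) (pol_expX a) x && in_ray (z || (a != 1)) (pol_expY 1 a) y.
Proof.
by case: z a x y => [] [|[|a]] [|x] [|y] //=;
  rewrite /in_ray /pol_expX /pol_expY /=; lia.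
Qed.

Lemma sum_bounded_points (T : pred nat) N :
  (forall t, T t -> t < N) ->
  forall t, \sum_(a <- iota 0 N | T a) in_ray false a t = T t.
Proof.
move=> T_lt t; have [Tt|nTt] := boolP (T t); last first.
  by rewrite big1 // => a Ta; apply/eqP; rewrite eqb0; apply: contraNneq nTt => ->.
rewrite -big_filter (bigD1_seq t) ?filter_uniq ?iota_uniq //=; last first.
  by rewrite mem_filter Tt mem_iota T_lt.
by rewrite eqxx big1 // => a; rewrite eq_sym => /negPf ->.
Qed.

(* Since [a < y], a cone with apex [a] and free in only one of the two
   directions meets the section in finitely many points. *)
Lemma pol_exp_ray_partition zX zY aX aY y : aY < y ->
  exists R : seq nat, forall t, \sum_(a <- R) in_ray (zX && zY) a t =
    in_ray zX aX (pol_expX t) && in_ray zY aY (pol_expY y t).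
Proof.
move=> aY_lt; have [/andP[-> ->]|nz] := boolP (zX && zY).
  exists [:: if aY is 0 then if aX is k.+2 then k.+3 else aX else (maxn aX 1).+1].
  move=> t; rewrite big_seq1; congr nat_of_bool.
  by case: aX aY t aY_lt => [|[|aX]] [|aY] [|[|t]] //=;
    rewrite /in_ray /pol_expX /pol_expY /=; lia.
exists [seq t <- iota 0 aX.+2 |
         in_ray zX aX (pol_expX t) && in_ray zY aY (pol_expY y t)] => t.
rewrite big_filter sum_bounded_points // => {}t.
move: nz; case: zX zY t => [] [] [|[|t]] //= _;
  by rewrite /in_ray /pol_expX /pol_expY /=; lia.
Qed.

Section Depolarization.
Variables (n : nat) (i : 'I_n).

Local Notation emb := (lift ord_max).

Definition depol (m : 'X_{1..n.+1}) : 'X_{1..n} :=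
  [multinom if k == i then depol_exp (m (emb k)) (m ord_max)
            else m (emb k) | k < n].

Definition depol_section (y : nat) (u : 'X_{1..n}) : 'X_{1..n.+1} :=
  [multinom (if unlift ord_max j is Some k
             then if k == i then pol_expX (u k) else u k
             else pol_expY y (u i)) | j < n.+1].

Lemma depol_section_lift y u k : depol_section y u (emb k) =
  if k == i then pol_expX (u k) else u k.
Proof. by rewrite mnmE liftK. Qed.

Lemma depol_section_max y u : depol_section y u ord_max = pol_expY y (u i).
Proof. by rewrite mnmE unlift_none. Qed.

Lemma depol_sectionK y : 0 < y -> cancel (depol_section y) depol.
Proof.
move=> y_gt0 u; apply/mnmP => k; rewrite mnmE depol_section_lift depol_section_max.
by case: eqVneq => [->|//]; apply: pol_expK.
Qed.

Lemma polmonE u : polmon i u = depol_section 1 u.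
Proof.
apply/mnmP => j; rewrite !mnmE; case: (unlift _ _) => // k.
by rewrite /pol_expX; case: eqP.
Qed.

Lemma in_coneD1 (p : cone n) b :
  in_cone p b = in_ray (i \in p.2) (p.1 i) (b i) &&
    [forall (k | k != i), in_ray (k \in p.2) (p.1 k) (b k)].
Proof. exact: forallD1. Qed.

Lemma in_cone_liftD1 (p : cone n.+1) m :
  in_cone p m = in_ray (emb i \in p.2) (p.1 (emb i)) (m (emb i)) &&
    in_ray (ord_max \in p.2) (p.1 ord_max) (m ord_max) &&
    [forall (k | k != i), in_ray (emb k \in p.2) (p.1 (emb k)) (m (emb k))].
Proof. by rewrite (in_cone_lift ord_max) (forallD1 i) andbCA andbA. Qed.

Lemma card_set_liftD1 (A : {set 'I_n.+1}) :
  #|A| = (ord_max \in A) + (emb i \in A) + #|emb @^-1: A :\ i|.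
Proof. by rewrite (card_set_lift ord_max) (cardsD1 i) inE addnA. Qed.

(* The fibre of [depol_exp] over [1] is the ray [x >= 1, y = 0]; over any other
   exponent it is a ray in the direction of [y]. *)
Definition pol_cone (p : cone n) : cone n.+1 :=
  (polmon i p.1,
   [set j | if unlift ord_max j is Some k
            then (k \in p.2) || (k == i) && (p.1 i == 1)
            else (i \in p.2) || (p.1 i != 1)]).

Lemma in_pol_cone p m : in_cone (pol_cone p) m = in_cone p (depol m).
Proof.
rewrite in_cone_liftD1 in_coneD1 /= polmonE.
rewrite depol_section_lift depol_section_max !inE liftK unlift_none mnmE eqxx.
rewrite in_ray_depol_exp; congr (_ && _); apply: eq_forallb => k.
case: eqVneq => //= /negPf ki.
by rewrite inE liftK depol_section_lift mnmE ki orbF.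
Qed.

Lemma card_pol_cone p : #|(pol_cone p).2| = #|p.2|.+1.
Proof.
rewrite card_set_liftD1 [#|p.2|](cardsD1 i) !inE liftK unlift_none eqxx.
rewrite -addSn; congr (_ + _); first by case: (i \in p.2); case: (_ == 1).
by apply: eq_card => k; rewrite !inE liftK; case: eqP; rewrite ?orbF.
Qed.

Lemma polmon_le u m : (polmon i u <= m)%MM = (u <= depol m)%MM.
Proof.
suff -> : (polmon i u <= m)%MM = in_cone (pol_cone (u, setT)) m.
  by rewrite in_pol_cone in_cone_setT.
rewrite -in_cone_setT; congr in_cone; congr pair; apply/setP => j.
by rewrite !inE; case: unlift => [k|] /=; rewrite ?inE.
Qed.

Lemma depol_mono m m' : (m <= m')%MM -> (depol m <= depol m')%MM.
Proof.
by move=> le_m; rewrite -polmon_le (lepm_trans _ le_m) // polmon_le lepm_refl.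
Qed.

Lemma cone_partitionable_depol (P : pred 'X_{1..n}) d :
  cone_partitionable P d -> cone_partitionable (P \o depol) d.+1.
Proof.
case=> C PC dC; apply: cone_partitionable_comp PC _ => p pC.
exists [:: pol_cone p] => [b|q]; first by rewrite big_seq1 in_pol_cone.
by rewrite inE => /eqP ->; rewrite card_pol_cone ltnS dC.
Qed.

Lemma cone_partitionable_section y (p : cone n.+1) :
  p.1 ord_max < y -> cone_partitionable (in_cone p \o depol_section y) #|p.2|.-1.
Proof.
move=> aY_lt.
have [R sumR] := pol_exp_ray_partition
  (emb i \in p.2) (ord_max \in p.2) (p.1 (emb i)) aY_lt.
pose a t := [multinom if k == i then t else p.1 (emb k) | k < n].
pose Z := [set k | (emb k \in p.2) && ((k == i) ==> (ord_max \in p.2))].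
exists [seq (a t, Z) | t <- R] => [b|_ /mapP[t _ ->] /=]; last first.
  rewrite card_set_liftD1 [#|Z|](cardsD1 i) inE eqxx.
  have -> : #|emb @^-1: p.2 :\ i| = #|Z :\ i|.
    by apply: eq_card => k; rewrite !inE; case: eqP; rewrite ?andbT.
  by case: (ord_max \in _); case: (emb i \in _) => /=; lia.
rewrite big_map /= in_cone_liftD1 depol_section_lift depol_section_max eqxx.
rewrite -mulnb -sumR big_distrl; apply: eq_bigr => t _.
rewrite in_coneD1 /= mulnb mnmE eqxx inE eqxx /=; congr (nat_of_bool (_ && _)).
apply: eq_forallb => k; case: eqVneq => //= /negPf ki.
by rewrite inE mnmE depol_section_lift ki andbT.
Qed.

Lemma cone_partitionable_undepol (P : pred 'X_{1..n}) d :
  cone_partitionable (P \o depol) d.+1 -> cone_partitionable P d.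
Proof.
case=> C PC dC; pose y := (\max_(p <- C) p.1 ord_max).+1.
have [|C' PC' dC'] := @cone_partitionable_comp _ _ (depol_section y) _ _ d PC.
  move=> p pC; have pY_lt : p.1 ord_max < y by rewrite ltnS (leq_bigmax_seq p).
  apply: cone_partitionableW (cone_partitionable_section pY_lt).
  by rewrite -ltnS (leq_trans (dC p pC)) ?leqSpred.
by exists C' => // b; rewrite PC' /= depol_sectionK.
Qed.

End Depolarization.

Local Open Scope ring_scope.

(** * Monomial ideals *)

Section MonomialIdeals.
Variables (K : fieldType) (n : nat).
Implicit Types (I : psubset K n) (U : pred 'X_{1..n}) (f g : {mpoly K[n]}).

Lemma ideal_gen_monomialsP (T : Type) (S : T -> Prop) (h : T -> 'X_{1..n}) f :
  ideal_gen (fun p => exists2 t, S t & p = 'X_[h t]) f <->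
  (forall m, m \in msupp f -> exists2 t, S t & (h t <= m)%MM).
Proof.
split=> [[r [Sr ->]] m /msupp_sum_le /flattenP[_ /mapP[p + ->]]|].
  rewrite filter_predT => /Sr[t St ->] /msuppM_le /allpairsP[[m1 m2] /= [_]].
  by rewrite msuppX inE => /eqP -> ->; exists t => //; apply: lem_addl.
rewrite [X in ideal_gen _ X]mpolyE; elim: (msupp f) => [_|m s IH Hs].
  by exists [::]; split=> //; rewrite !big_nil.
have [|r [Sr sum_r]] := IH.
  by move=> m' m's; apply: Hs; rewrite inE m's orbT.
have [t St le_tm] := Hs m (mem_head _ _).
exists ((f@_m *: 'X_[m - h t], 'X_[h t]) :: r); split=> [p|].
  by rewrite inE => /predU1P[-> /=|/Sr //]; exists t.
by rewrite !big_cons sum_r /= -scalerAl -mpolyXD submK.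
Qed.

Definition up_closed U : Prop := forall a b, (a <= b)%MM -> U a -> U b.

Definition spanned_by I U : Prop :=
  forall f, I f <-> forall m, ~~ U m -> f@_m = 0.

Lemma spanned_by_msupp I U :
  (forall f, I f <-> {in msupp f, forall m, U m}) -> spanned_by I U.
Proof.
move=> IU f; rewrite IU; split=> H m => [|mf].
  by move=> nUm; apply: memN_msupp_eq0; apply: contra nUm => /H.
by apply: contraTT mf => /H /eqP; rewrite mcoeff_eq0.
Qed.

Lemma spanned_byX I U m : spanned_by I U -> I 'X_[m] <-> U m.
Proof.
move=> IU; rewrite IU; split=> [H|Um m' nUm'].
  by apply: contraT => /H /eqP; rewrite mcoeffX eqxx oner_eq0.
by rewrite mcoeffX; case: eqVneq => // mm'; rewrite -mm' Um in nUm'.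
Qed.

Lemma spanned_byM I U f g : spanned_by I U -> up_closed U -> I f -> I (f * g).
Proof.
move=> IU upU /IU f0; apply/IU => m nUm; rewrite mcoeffM big1 // => k /eqP mE.
rewrite f0 ?mul0r //; apply: contra nUm; apply: upU.
by rewrite [X in (_ <= X)%MM]mE lem_addr.
Qed.

Lemma lepm_truncate_mon (u b : 'X_{1..n}) N :
  (mdeg u <= N)%N -> (u <= truncate_mon N b)%MM = (u <= b)%MM.
Proof.
move=> le_uN; apply/mnm_lepP/mnm_lepP => le_u j; have := le_u j;
  rewrite mnmE leq_min.
  by case/andP.
by move=> ->; rewrite (leq_trans _ le_uN) // mdegE (bigD1 j) //= leq_addr.
Qed.

Lemma monomial_ideal_spanned I : monomial_ideal I ->
  exists U N, [/\ spanned_by I U, up_closed U & truncation_invariant N U].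
Proof.
case=> s Is; exists (fun m => has (fun u => (u <= m)%MM) s), (\max_(u <- s) mdeg u).
split.
- apply: spanned_by_msupp => f.
  rewrite Is (ideal_gen_monomialsP (fun u => u \in s) id).
  split=> H m /H; last by case/hasP=> u; exists u.
  by case=> u us le_um; apply/hasP; exists u.
- move=> a b le_ab /hasP[u us le_ua]; apply/hasP; exists u => //.
  exact: lepm_trans le_ab.
- move=> b; apply: eq_in_has => u us.
  by rewrite lepm_truncate_mon // (leq_bigmax_seq u).
Qed.

Lemma min_mon_gen_exists I U m : spanned_by I U -> U m ->
  exists2 u, min_mon_gen I u & (u <= m)%MM.
Proof.
move=> IU Um; pose P (u : 'X_{1..n < (mdeg m).+1}) := U u && (u <= m)%MM.
have Pm : P (BMultinom (ltnSn (mdeg m))) by rewrite /P /= Um lepm_refl.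
case: (arg_minnP (fun u => mdeg (bmnm u)) Pm) => u /andP[Uu le_um] u_min.
exists (bmnm u) => //; split=> [|m' /(spanned_byX _ IU) Um' le_m'u].
  exact/(spanned_byX _ IU).
have le_m'm := lepm_trans le_m'u le_um.
have ltm' : (mdeg m' < (mdeg m).+1)%N.
  by rewrite -(submK le_m'm) mdegD ltnS leq_addl.
have : (mdeg u <= mdeg m')%N by apply: (u_min (BMultinom ltm')); rewrite /P /= Um'.
rewrite -{1}(submK le_m'u) mdegD -[leqRHS]add0n leq_add2r leqn0 mdeg_eq0.
move=> /eqP um'.
by rewrite -(submK le_m'u) um' add0m.
Qed.

End MonomialIdeals.

Lemma polarization_spanned (K : fieldType) n (i : 'I_n) (I : psubset K n) U :
  spanned_by I U -> up_closed U -> spanned_by (polarization i I) (U \o depol i).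
Proof.
move=> IU upU; apply: spanned_by_msupp => f.
rewrite /polarization ideal_gen_monomialsP; split=> H m /H /=.
  by case=> u [/(spanned_byX u IU) Uu _]; rewrite polmon_le => le_u; apply: upU Uu.
by case/(min_mon_gen_exists IU) => u u_min le_u; exists u; rewrite ?polmon_le.
Qed.

Lemma up_closed_depol n (i : 'I_n) (U : pred 'X_{1..n}) :
  up_closed U -> up_closed (U \o depol i).
Proof. by move=> upU a b le_ab; apply: upU; apply: depol_mono. Qed.

(** * Stanley decompositions *)

Section ConeSubmodules.
Variables (K : fieldType) (n : nat).
Implicit Types (a m : 'X_{1..n}) (Z : {set 'I_n}) (f g : {mpoly K[n]}).

Lemma mpolyX_neq0 m : 'X_[m] != 0 :> {mpoly K[n]}.
Proof. by rewrite -msupp_eq0 msuppX. Qed.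

Lemma mulX_sub a m : (a <= m)%MM -> 'X_[a] * 'X_[m - a] = 'X_[m] :> {mpoly K[n]}.
Proof. by move=> le_am; rewrite -mpolyXD addmC submK. Qed.

Lemma in_subringZ Z (c : K) g : in_subring Z g -> in_subring Z (c *: g).
Proof. by move=> gZ m /msuppZ_le; apply: gZ. Qed.

Lemma in_subring_cone a Z m :
  in_cone (a, Z) m -> in_subring Z ('X_[m - a] : {mpoly K[n]}).
Proof.
move=> azm m'; rewrite msuppX inE => /eqP ->.
by apply/(in_cone_addP (a, Z)); rewrite addmC submK ?(lepm_in_cone azm).
Qed.

Lemma mcoeffXM_notin_cone a Z g m :
  in_subring Z g -> ~~ in_cone (a, Z) m -> ('X_[a] * g)@_m = 0.
Proof.
move=> gZ; apply: contraNeq; rewrite -mcoeff_msupp => /msuppM_le.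
case/allpairsP => -[m1 m2] /= [+ /gZ m2Z ->]; rewrite msuppX inE => /eqP ->.
exact/(in_cone_addP (a, Z)).
Qed.

Lemma cone_component a Z f : exists g,
  in_subring Z g /\ forall m, ('X_[a] * g)@_m = f@_m *+ in_cone (a, Z) m.
Proof.
exists (\sum_(m <- msupp f | in_cone (a, Z) m) f@_m *: 'X_[m - a]); split=> m.
  move=> /msupp_sum_le /flattenP[_ /mapP[m' + ->]].
  rewrite mem_filter => /andP[azm' _].
  exact/in_subringZ/in_subring_cone.
rewrite mulr_sumr raddf_sum /=; under eq_bigr => m' /lepm_in_cone le_am'
  do rewrite -scalerAr mulX_sub // mcoeffZ mcoeffX.
have [mf|mNf] := boolP (m \in msupp f); last first.
  rewrite big1_seq ?(memN_msupp_eq0 mNf) ?mul0rn // => m' /andP[_ m'f].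
  by case: eqVneq m'f => [->|_ _]; rewrite ?(negPf mNf) // mulr0.
rewrite big_mkcond (bigD1_seq m) ?msupp_uniq //= big1 => [|m' /negPf ->].
  by rewrite eqxx mulr1 addr0; case: ifP.
by rewrite mulr0 if_same.
Qed.

End ConeSubmodules.

Section StanleyFamilies.
Variables (K : fieldType) (n : nat) (I J : psubset K n).

Definition stanley_family (T : finType) (u : T -> {mpoly K[n]})
    (Z : T -> {set 'I_n}) : Prop :=
  [/\ forall k, I (u k) /\ exists (c : K) (a : 'X_{1..n}), J (u k - c *: 'X_[a]),
      forall k g, in_subring (Z k) g -> J (u k * g) -> g = 0,
      forall f, I f -> exists2 gs, (forall k, in_subring (Z k) (gs k)) &
        J (f - \sum_k u k * gs k)
    & forall gs, (forall k, in_subring (Z k) (gs k)) -> J (\sum_k u k * gs k) ->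
        forall k, J (u k * gs k)].

Lemma stanley_decompositionP D :
  stanley_decomposition I J D <->
  stanley_family (fun k : 'I_(size D) => (nth (0, set0) D k).1)
                 (fun k => (nth (0, set0) D k).2).
Proof.
pose ext (gs : 'I_(size D) -> {mpoly K[n]}) k :=
  if insub k is Some k' then gs k' else 0.
have extE gs (k : 'I_(size D)) : ext gs k = gs k by rewrite /ext valK.
pose Z k := (nth (0, set0) D k).2.
have extZ gs : (forall k : 'I_(size D), in_subring (Z k) (gs k)) ->
    forall k, (k < size D)%N -> in_subring (Z k) (ext gs k).
  by move=> gsZ k ltk; rewrite (extE gs (Ordinal ltk)); apply: (gsZ (Ordinal ltk)).
split=> [[hom [free [span indep]]]|[hom free span indep]].
  split=> [k|k|f /span[gs [gsZ Jf]]|gs gsZ Js k].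
  - exact: hom.
  - exact: free.
  - by exists (fun k : 'I_(size D) => gs k) => // k; apply: gsZ.
  - rewrite -extE; apply: indep => //; first exact: extZ.
    by under eq_bigr do rewrite extE.
split; [|split; [|split]] => [k ltk|k ltk|f /span[gs gsZ Jf]|gs gsZ Js k ltk].
- exact: (hom (Ordinal ltk)).
- exact: (free (Ordinal ltk)).
- exists (ext gs); split; first exact: extZ.
  by under eq_bigr do rewrite extE.
- apply: (indep (fun l : 'I_(size D) => gs l) _ Js (Ordinal ltk)) => l.
  exact: gsZ.
Qed.

End StanleyFamilies.

Section HomogeneousFamilies.
Variables (K : fieldType) (n : nat) (I J : psubset K n) (U V : pred 'X_{1..n}).
Hypotheses (IU : spanned_by I U) (upU : up_closed U).
Hypotheses (JV : spanned_by J V) (upV : up_closed V).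
Variables (T : finType) (u : T -> {mpoly K[n]}) (Z : T -> {set 'I_n}).
Variables (c : T -> K) (a : T -> 'X_{1..n}).
Hypothesis u_homog : forall k, J (u k - c k *: 'X_[a k]).

Local Notation cone_at k := (a k, Z k).

Lemma mcoeff_homogM k g m : ~~ V m -> (u k * g)@_m = c k * ('X_[a k] * g)@_m.
Proof.
move=> nVm; apply/eqP; rewrite -subr_eq0 -mcoeffZ scalerAl -mcoeffB -mulrBl.
by have /JV -> := spanned_byM g JV upV (u_homog k).
Qed.

Section FromPartition.
Hypothesis Iu : forall k, I (u k).
Hypothesis c_neq0 : forall k, c k != 0.
Hypothesis partition_cones :
  forall b, (\sum_k in_cone (cone_at k) b = (U b && ~~ V b))%N.

Lemma partition_mem k b : in_cone (cone_at k) b -> U b && ~~ V b.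
Proof.
move=> kb; apply: contraT => /negPf nUVb.
by have /eqP := partition_cones b; rewrite nUVb (bigD1 k) //= kb addn_eq0.
Qed.

Lemma partition_disjoint k l b :
  in_cone (cone_at k) b -> in_cone (cone_at l) b -> k = l.
Proof.
move=> kb lb; apply/eqP; apply: contraT => neq; have := partition_cones b.
by rewrite (bigD1 k) // (bigD1 l) 1?eq_sym //= kb lb (partition_mem kb) !add1n.
Qed.

Lemma partition_stanley_free k g : in_subring (Z k) g -> J (u k * g) -> g = 0.
Proof.
move=> gZ /JV ug0; apply/mpolyP => m; rewrite mcoeff0; apply/eqP.
have XgE : ('X_[a k] * g)@_(a k + m) = g@_m by rewrite mulrC mcoeffMX.
apply: contraT => gm0; have kam : in_cone (cone_at k) (a k + m)%MM.
  by apply: contraR gm0 => /(mcoeffXM_notin_cone gZ); rewrite XgE => ->.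
have /andP[_ nV] := partition_mem kam.
have /eqP := ug0 _ nV; rewrite mcoeff_homogM // XgE mulf_eq0.
by rewrite (negPf (c_neq0 k)) (negPf gm0).
Qed.

Lemma partition_stanley_span f : I f ->
  exists2 gs, (forall k, in_subring (Z k) (gs k)) & J (f - \sum_k u k * gs k).
Proof.
move=> /IU f0; have [gs /all_and2[gsZ gsE]] :=
  fin_all_exists (fun k => cone_component (a k) (Z k) ((c k)^-1 *: f)).
exists gs => //; apply/JV => m nVm; rewrite mcoeffB raddf_sum /=.
under eq_bigr => k _ do rewrite mcoeff_homogM // gsE mcoeffZ -mulrnAr mulVKf //.
rewrite sumrMnr partition_cones nVm andbT.
by case: (boolP (U m)) => [_|/f0 ->]; rewrite ?mul0rn subrr.
Qed.

Lemma partition_stanley_indep gs : (forall k, in_subring (Z k) (gs k)) ->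
  J (\sum_k u k * gs k) -> forall k, J (u k * gs k).
Proof.
move=> gsZ /JV s0 k; apply/JV => m nVm.
have out l : ~~ in_cone (cone_at l) m -> (u l * gs l)@_m = 0.
  by move=> lm; rewrite mcoeff_homogM // (mcoeffXM_notin_cone (gsZ l)) ?mulr0.
have [km|/out //] := boolP (in_cone (cone_at k) m).
have := s0 m nVm; rewrite raddf_sum (bigD1 k) //= big1 ?addr0 // => l neq.
by apply: out; apply: contra neq => /(partition_disjoint km) ->.
Qed.

Lemma partition_stanley_family : stanley_family I J u Z.
Proof.
split; first by move=> k; split; [exact: Iu | exists (c k), (a k)].
- exact: partition_stanley_free.
- exact: partition_stanley_span.
- exact: partition_stanley_indep.
Qed.

End FromPartition.

Section ToPartition.
Hypothesis stanley_u : stanley_family I J u Z.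

Lemma stanley_cone_nonzero k m : in_cone (cone_at k) m -> ~ J (u k * 'X_[m - a k]).
Proof.
case: stanley_u => _ free _ _ km /(free _ _ (in_subring_cone km)) /eqP.
by rewrite (negPf (mpolyX_neq0 _ _)).
Qed.

Lemma mcoeff_stanley_cone k m m' : in_cone (cone_at k) m -> ~~ V m' ->
  (u k * 'X_[m - a k])@_m' = c k *+ (m == m').
Proof.
move=> km nVm'; rewrite mcoeff_homogM // mulX_sub ?(lepm_in_cone km) //.
by rewrite mcoeffX mulr_natr.
Qed.

Lemma stanley_cone_avoids k m : in_cone (cone_at k) m -> ~~ V m.
Proof.
move=> km; apply/negP => Vm; apply: (stanley_cone_nonzero km); apply/JV => m' nVm'.
by rewrite mcoeff_stanley_cone //; case: eqVneq nVm' => // <-; rewrite Vm.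
Qed.

Lemma stanley_coef_neq0 k m : in_cone (cone_at k) m -> c k != 0.
Proof.
move=> km; apply/eqP => c0; apply: (stanley_cone_nonzero km); apply/JV => m' nVm'.
by rewrite mcoeff_stanley_cone // c0 mul0rn.
Qed.

Lemma stanley_cone_sub k m : in_cone (cone_at k) m -> U m.
Proof.
case: stanley_u => hom _ _ _ km; have [Iu _] := hom k.
have /IU u0 := spanned_byM 'X_[m - a k] IU upU Iu.
apply: contraT => /u0 /eqP.
rewrite mcoeff_stanley_cone ?(stanley_cone_avoids km) //.
by rewrite eqxx (negPf (stanley_coef_neq0 km)).
Qed.

Lemma stanley_cone_cover m : U m -> ~~ V m -> exists k, in_cone (cone_at k) m.
Proof.
case: stanley_u => _ _ span _ /(spanned_byX m IU)/span[gs gsZ /JV X0] nVm.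
apply/existsP; apply: contraT; rewrite negb_exists => /forallP none.
have /eqP := X0 m nVm; rewrite mcoeffB mcoeffX eqxx raddf_sum /=.
rewrite big1 ?subr0 ?oner_eq0 // => k _.
by rewrite mcoeff_homogM // (mcoeffXM_notin_cone (gsZ k) (none k)) mulr0.
Qed.

(* Two cones sharing [m] would give the nontrivial relation
   [c l X^(m - a k) u k - c k X^(m - a l) u l = 0] modulo [J]. *)
Lemma stanley_cone_disjoint k l m :
  in_cone (cone_at k) m -> in_cone (cone_at l) m -> k = l.
Proof.
case: stanley_u => _ _ _ indep km lm; apply/eqP; apply: contraT => neq.
have nVm := stanley_cone_avoids km.
pose gs j := if j == k then c l *: 'X_[m - a k]
             else if j == l then - c k *: 'X_[m - a l] else 0.
have gsZ j : in_subring (Z j) (gs j).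
  rewrite /gs; case: eqP => [->|_]; first exact/in_subringZ/(in_subring_cone km).
  case: eqP => [->|_]; first exact/in_subringZ/(in_subring_cone lm).
  by move=> m'; rewrite msupp0.
have Js : J (\sum_j u j * gs j).
  apply/JV => m' nVm'; rewrite raddf_sum /=.
  rewrite (bigD1 k) // (bigD1 l) 1?eq_sym //= big1.
    rewrite /gs eqxx eq_sym (negPf neq) eqxx -!scalerAr !mcoeffZ.
    rewrite !mcoeff_stanley_cone // addr0.
    by rewrite mulNr !mulrnAr [c l * _]mulrC subrr.
  by move=> j /andP[/negPf jk /negPf jl]; rewrite /gs jk jl mulr0 mcoeff0.
have /JV/(_ m nVm)/eqP := indep gs gsZ Js k.
rewrite /gs eqxx -scalerAr mcoeffZ mcoeff_stanley_cone // eqxx mulf_eq0.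
by rewrite (negPf (stanley_coef_neq0 km)) (negPf (stanley_coef_neq0 lm)).
Qed.

Lemma stanley_family_partition b :
  (\sum_k in_cone (cone_at k) b = (U b && ~~ V b))%N.
Proof.
have [/andP[Ub nVb]|nUVb] := boolP (U b && ~~ V b); last first.
  rewrite big1 // => k _; apply/eqP; rewrite eqb0; apply: contra nUVb => kb.
  by rewrite (stanley_cone_sub kb) (stanley_cone_avoids kb).
have [k kb] := stanley_cone_cover Ub nVb.
rewrite (bigD1 k) //= kb big1 // => l neq; apply/eqP; rewrite eqb0.
by apply: contra neq => /(stanley_cone_disjoint kb) ->.
Qed.

End ToPartition.

End HomogeneousFamilies.

Section StanleyDecompositions.
Variables (K : fieldType) (n : nat) (I J : psubset K n) (U V : pred 'X_{1..n}).
Hypotheses (IU : spanned_by I U) (upU : up_closed U).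
Hypotheses (JV : spanned_by J V) (upV : up_closed V).

Lemma stanley_of_cone_partition C :
  cone_partition [pred b | U b && ~~ V b] C ->
  stanley_decomposition I J [seq ('X_[p.1], p.2) | p <- C].
Proof.
move=> PC; pose p0 : cone n := (0%MM, set0).
pose gen (p : cone n) : {mpoly K[n]} * {set 'I_n} := ('X_[p.1], p.2).
pose D := map gen C; pose a (k : 'I_(size D)) := (nth p0 C k).1.
pose Z (k : 'I_(size D)) := (nth (0, set0) D k).2.
have nthD (k : 'I_(size D)) : nth (0, set0) D k = gen (nth p0 C k).
  by rewrite (nth_map p0) // -(size_map gen).
have partD b : (\sum_k in_cone (a k, Z k) b = (U b && ~~ V b))%N.
  rewrite -[RHS](PC b) (big_nth p0) big_mkord -(size_map gen).
  by apply: eq_bigr => k _; rewrite /Z nthD /a; case: (nth p0 C k).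
apply/stanley_decompositionP.
apply: (partition_stanley_family (c := fun=> 1) IU JV upV _ _ _ partD) => k.
- by rewrite nthD scale1r subrr; apply/JV => m _; rewrite mcoeff0.
- rewrite nthD; apply/(spanned_byX _ IU).
  by have /andP[] := partition_mem partD (in_cone_apex (a k, Z k)).
- exact: oner_neq0.
Qed.

Lemma cone_partition_of_stanley D : stanley_decomposition I J D ->
  exists2 C, cone_partition [pred b | U b && ~~ V b] C &
    [seq p.2 | p <- C] = [seq p.2 | p <- D].
Proof.
move=> /stanley_decompositionP stD; have [hom _ _ _] := stD.
have [c /fin_all_exists[a u_homog]] := fin_all_exists (fun k => (hom k).2).
exists [seq (a k, (nth (0, set0) D k).2) | k : 'I_(size D)] => [b|].
  rewrite big_image /=; exact: (stanley_family_partition IU upU JV upV u_homog).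
by rewrite -[in RHS](mkseq_nth (0, set0) D) /mkseq -val_enum_ord -!map_comp.
Qed.

Lemma has_sdecomp_geP d :
  has_sdecomp_ge I J d <-> cone_partitionable [pred b | U b && ~~ V b] d.
Proof.
suff sdecE : (exists D, stanley_decomposition I J D /\ depth_ge D d) <->
    cone_partitionable [pred b | U b && ~~ V b] d.
  by rewrite -sdecE /has_sdecomp_ge; case: excluded_middle_informative.
split=> [[D [/cone_partition_of_stanley[C PC CD] dD]]|[C PC dC]].
  by exists C => // p /(map_f snd); rewrite CD => /mapP[q /dD + ->].
exists [seq ('X_[p.1], p.2) | p <- C].
split; first exact: stanley_of_cone_partition.
by move=> _ /mapP[p /dC dp ->].
Qed.

End StanleyDecompositions.

(** * Stanley depth *)

Section Sdepth.
Variables (K : fieldType) (n : nat) (I J : psubset K n).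

Lemma leq_sdepth d : (d <= n)%N -> has_sdecomp_ge I J d -> (d <= sdepth I J)%N.
Proof.
rewrite -ltnS => ltd dI.
exact: (@bigmax_sup _ (Ordinal ltd) (fun d : 'I_n.+1 => has_sdecomp_ge I J d)).
Qed.

Lemma sdepth_leq : (sdepth I J <= n)%N.
Proof. by apply/bigmax_leqP => d _; rewrite -ltnS. Qed.

Lemma has_sdecomp_sdepth :
  has_sdecomp_ge I J 0 -> has_sdecomp_ge I J (sdepth I J).
Proof.
move=> has0; have [|d dI sdE] := @eq_bigmax_cond _
  [pred d : 'I_n.+1 | has_sdecomp_ge I J d] (fun d : 'I_n.+1 => d : nat).
  by apply/card_gt0P; exists ord0.
by have -> : sdepth I J = d by rewrite -sdE.
Qed.

End Sdepth.

Lemma sdepth_succ (K : fieldType) n (I J : psubset K n) (I' J' : psubset K n.+1) :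
  has_sdecomp_ge I J 0 ->
  (forall d, has_sdecomp_ge I' J' d.+1 = has_sdecomp_ge I J d) ->
  sdepth I' J' = (sdepth I J).+1.
Proof.
move=> has0 hasS; apply/eqP; rewrite eqn_leq; apply/andP; split.
  apply/bigmax_leqP => -[[|d] ltd] //=; rewrite hasS ltnS; exact: leq_sdepth.
by apply: leq_sdepth; rewrite ?hasS ?has_sdecomp_sdepth // ltnS sdepth_leq.
Qed.

Theorem theorem4p3 (K : fieldType) (n : nat) (I J : psubset K n) (i : 'I_n) :
  monomial_ideal I -> monomial_ideal J ->
  (forall f, J f -> I f) -> (exists f, I f /\ ~ J f) ->
  ((sdepth I J)%:Z =
   (sdepth (polarization i I) (polarization i J))%:Z - 1)%R.
Proof.
move=> /monomial_ideal_spanned[U [N [IU upU truncU]]].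
move=> /monomial_ideal_spanned[V [N' [JV upV truncV]]] _ _.
have sdecE d := has_sdecomp_geP IU upU JV upV d.
have sdec_polE d := has_sdecomp_geP
  (polarization_spanned i IU upU) (up_closed_depol (i := i) upU)
  (polarization_spanned i JV upV) (up_closed_depol (i := i) upV) d.
rewrite (@sdepth_succ _ _ I J) => [||d]; first by rewrite -addn1 PoszD addrK.
  apply/sdecE; apply: (@truncation_invariant_partitionable _ (N + N')) => b /=.
  by rewrite (truncation_invariantW (leq_addr N' N) truncU)
    (truncation_invariantW (leq_addl N N') truncV).
apply/idP/idP => [/sdec_polE/cone_partitionable_undepol/sdecE //|].
by move/sdecE/(cone_partitionable_depol i)/sdec_polE.
Qed.
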